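(* If $\alpha>0$, $1<\beta<3$ and $\tanh\big(\frac{\pi\alpha}{6}\big)\tan\big(\frac{\pi\beta}{6}\big)=1/\sqrt{3}$, then \[ \prod_{\substack{n=1\\ n\neq 3}}^\infty\left(\frac{(n^2+\alpha^2)(n^2-\beta^2)}{n^2(n^2-9)}\right)^{n\chi_{6}(n)}=e^{-\pi\alpha\beta/3}. \]
   Context: $\chi_6$ is the odd Dirichlet character modulo $6$: $\chi_6(n)=1$ if $n\equiv 1\pmod 6$, $\chi_6(n)=-1$ if $n\equiv 5\pmod 6$, and $\chi_6(n)=0$ otherwise. The infinite product is the limit as $N\to\infty$ of the partial products over $1\le n\le N$, $n\ne 3$; factors with exponent $0$ equal $1$. *)

(* Defs.v *)
From Stdlib Require Import Reals ZArith Arith List.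
From Coquelicot Require Import Coquelicot.

Definition chi6 (n : nat) : Z :=
  match (n mod 6)%nat with
  | 1%nat => 1%Z
  | 5%nat => (-1)%Z
  | _ => 0%Z
  end.

Open Scope R_scope.

(* [powerRZ x 0 = 1] for every [x], so factors with [chi6 n = 0] equal 1. *)
Definition factor (alpha beta : R) (n : nat) : R :=
  powerRZ
    (((INR n ^ 2 + alpha ^ 2) * (INR n ^ 2 - beta ^ 2))
       / (INR n ^ 2 * (INR n ^ 2 - 9)))
    (Z.of_nat n * chi6 n).

(* The product over 1 <= n <= N with n <> 3; [seq 1 N] lists 1, 2, ..., N, and
   the product with N = 0 is 1. *)
Definition partial_product (alpha beta : R) (N : nat) : R :=
  fold_right Rmult 1
    (map (factor alpha beta)
       (filter (fun n => negb (Nat.eqb n 3)) (seq 1 N))).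

(* Main.v *)
Require Import Defs.
From Stdlib Require Import Reals ZArith Arith List Lra Lia.
From Coquelicot Require Import Coquelicot.
Open Scope R_scope.

(** Write [chi] for the character [chi6].  Taking logarithms, the claim is

      [sum n chi(n) ln ((n^2 + a^2) (n^2 - b^2) / (n^2 (n^2 - 9)))
         = - PI a b / 3]   for [a = alpha], [b = beta],

    where the [n] with [chi(n) <> 0] come in pairs [6k+1], [6k+5].  The
    hypothesis relating [a] and [b] describes a curve [b = curve a] which
    starts at [curve 0 = 3].  At that point every factor of the product is 1
    and the right-hand side is 0, so it is enough to compare derivatives along
    the curve.

    Differentiating the logarithms produces two series of the same type,
    [sum chi(n) 2n / (n^2 + kappa)] with [kappa = a^2] and [kappa = - b^2].
    Both have a closed form, [(PI / sqrt 3) / (2 c(PI/3) - 1)] with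
    [c(h) = cosh (a h)] and [c(h) = cos (b h)] respectively.  On the curve,
    [2 cos (PI b / 3) - 1 = - 3 / (2 cosh (PI a / 3) - 1)] and
    [b' = - sqrt 3 / (2 cosh (PI a / 3) - 1)]; with these two facts the closed
    forms cancel exactly against the derivative of [PI a b / 3].

    To pass to the limit in the derivatives one needs the closed form with a
    remainder uniform along the curve ([fraction_sum]): the sum of the first
    [K] pairs is within [12 / (K - 1)] of it.  This is proved without complex
    analysis, simultaneously for [cosh] and [cos], by a doubling argument.  The
    kernel [sin t / (c - cos t)] obeys a duplication formula ([kern_double])
    which turns its sum over the angles [(6k+1) h], [(6k+5) h] with
    [h = PI / (6 * 2^j)] and [k < 2^j] into a sum of the same kind with half
    the step.  So [h] times this sum does not depend on [j]
    ([kern_pair_sum]).  As [h] tends to 0 each term tends to the corresponding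
    term of the series ([kern_lim]), while the [k]-th pair is at most
    [12 / k^2] for every [j] ([kern_pair_bound]): truncating at [K] before
    letting [j] grow gives both the value and the error.

    With the remainder at hand, the mean value theorem bounds the logarithm of
    the [6K]-th partial product plus [PI a b / 3] by a constant over [K - 1]
    ([defect_lim]).  The other residues modulo 6 follow because
    [n chi(n) ln(...)] tends to 0 ([logfactor_lim]). *)

(** * Finite sums *)

Fixpoint Rsum (a : nat -> R) (n : nat) : R :=
  match n with O => 0 | S n => Rsum a n + a n end.

Lemma Rsum_ext (a b : nat -> R) (n : nat) :
  (forall k, (k < n)%nat -> a k = b k) -> Rsum a n = Rsum b n.
Proof.
induction n as [|n IH]; intros H; simpl; [easy|].
rewrite IH by (intros; apply H; lia). rewrite (H n) by lia. easy.
Qed.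

Lemma Rsum_scal (x : R) (a : nat -> R) (n : nat) :
  Rsum (fun k => x * a k) n = x * Rsum a n.
Proof. induction n as [|n IH]; simpl; [ring|rewrite IH; ring]. Qed.

Lemma Rsum_plus (a b : nat -> R) (n : nat) :
  Rsum (fun k => a k + b k) n = Rsum a n + Rsum b n.
Proof. induction n as [|n IH]; simpl; [ring|rewrite IH; ring]. Qed.

Lemma Rsum_cat (a : nat -> R) (n m : nat) :
  Rsum a (n + m) = Rsum a n + Rsum (fun k => a (n + k)%nat) m.
Proof.
induction m as [|m IH]; simpl.
- rewrite Nat.add_0_r; ring.
- rewrite Nat.add_succ_r; simpl; rewrite IH; ring.
Qed.

Lemma Rsum_rev (n : nat) : forall a : nat -> R,
  Rsum (fun k => a (n - 1 - k)%nat) n = Rsum a n.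
Proof.
induction n as [|n IH]; intros a; [easy|].
replace (Rsum a (S n)) with (Rsum (fun k => a (S k)) n + a O).
- rewrite <- IH. simpl.
  replace (n - 0 - n)%nat with O by lia. f_equal.
  apply Rsum_ext; intros k Hk; f_equal; lia.
- clear. change (S n) with (1 + n)%nat. rewrite Rsum_cat. simpl. ring.
Qed.

Lemma Rsum_fold (a : nat -> R) (n : nat) :
  Rsum a (2 * n) = Rsum (fun k => a k + a (2 * n - 1 - k)%nat) n.
Proof.
replace (2 * n)%nat with (n + n)%nat by lia.
rewrite Rsum_cat, Rsum_plus, <- (Rsum_rev n (fun k => a (n + k)%nat)).
f_equal. apply Rsum_ext; intros k Hk; f_equal; lia.
Qed.

Lemma Rsum_lim (a : nat -> nat -> R) (l : nat -> R) (n : nat) :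
  (forall k, (k < n)%nat -> is_lim_seq (fun j => a j k) (l k)) ->
  is_lim_seq (fun j => Rsum (a j) n) (Rsum l n).
Proof.
induction n as [|n IH]; intros H; simpl.
- apply is_lim_seq_const.
- apply is_lim_seq_plus'; [apply IH; intros; apply H; lia | apply H; lia].
Qed.

(** Telescoping: [1 / k^2 <= 1 / (k - 1) - 1 / k]. *)
Lemma Rsum_tail (a : nat -> R) (C : R) (K N : nat) :
  (2 <= K <= N)%nat ->
  (forall k, (K <= k < N)%nat -> Rabs (a k) <= C / INR k ^ 2) ->
  0 <= C ->
  Rabs (Rsum a N - Rsum a K) <= C / (INR K - 1) - C / (INR N - 1).
Proof.
intros [HK HN] H HC.
induction HN as [|N HN IH].
- rewrite Rminus_diag, Rabs_R0. lra.
- simpl Rsum.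
  assert (H1 := IH ltac:(intros; apply H; lia)).
  assert (H2 := H N ltac:(lia)).
  assert (HI : 2 <= INR N) by (apply (le_INR 2); lia).
  replace (Rsum a N + a N - Rsum a K) with ((Rsum a N - Rsum a K) + a N) by ring.
  eapply Rle_trans; [apply Rabs_triang|].
  eapply Rle_trans; [apply Rplus_le_compat; [exact H1|exact H2]|].
  rewrite S_INR.
  assert (E : C / (INR N - 1) - C / (INR N + 1 - 1) - C / INR N ^ 2
      = C / (INR N ^ 2 * (INR N - 1))) by (field; lra).
  assert (0 <= C / (INR N ^ 2 * (INR N - 1))).
  { apply Rmult_le_pos; [easy|]. apply Rlt_le, Rinv_0_lt_compat. nra. }
  lra.
Qed.

(** * The duplication formula for the conjugate Poisson kernel *)

(** For [c = cosh a] this is the conjugate Poisson kernel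
    [2 * sum_(n >= 1) exp (- n a) sin (n t)]; the values [c = cos b] are its
    continuation to imaginary [a]. *)
Definition kern (c t : R) : R := sin t / (c - cos t).

(** With [C = 2 c^2 - 1] the denominator factors,
    [C - cos 2t = 2 (c - cos t) (c + cos t)], and the numerator is
    [2 sin t cos t]: this is a partial fraction decomposition. *)
Lemma kern_double (c t : R) :
  2 * c ^ 2 - 1 <> cos (2 * t) ->
  kern (2 * c ^ 2 - 1) (2 * t) = / 2 * (kern c t - kern c (PI - t)).
Proof.
unfold kern. rewrite cos_2a_cos, sin_2a. intros H.
rewrite Rtrigo_facts.cos_pi_minus, Rtrigo_facts.sin_pi_minus.
field. repeat split; intro E; apply H; nra.
Qed.

Definition kern_pair (c h : R) (k : nat) : R :=
  kern c (INR (6 * k + 1) * h) - kern c (INR (6 * k + 5) * h).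

(** What the argument uses about [h |-> cosh (a h)], with [kappa = a^2], and
    [h |-> cos (b h)], with [kappa = - b^2]: the duplication formula, the
    second-order behaviour at 0, and the absence of poles.  The constant [9 / 2]
    comes from [b <= 3]. *)
Record cos_like (c : R -> R) (kappa : R) : Prop := {
  cl_double : forall h, c (2 * h) = 2 * c h ^ 2 - 1;
  cl_lim : is_lim (fun h => (1 - c h) / h ^ 2) 0 (- (kappa / 2));
  cl_low : forall h, 0 < h -> 1 - c h <= 9 / 2 * h ^ 2;
  cl_sep : forall N k : nat, (k < N)%nat ->
    c (PI / (6 * INR N)) <> cos (INR (6 * k + 1) * (PI / (6 * INR N))) /\
    c (PI / (6 * INR N)) <> cos (INR (6 * k + 5) * (PI / (6 * INR N)));
  cl_pole : forall k : nat,
    INR (6 * k + 1) ^ 2 + kappa <> 0 /\ INR (6 * k + 5) ^ 2 + kappa <> 0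
}.

(** Duplication sends [6k+1] to [6k+1] and [12N - (6k+1) = 6k' + 5], and [6k+5]
    to [6k+5] and [12N - (6k+5) = 6k' + 1], where [k' = 2N - 1 - k].  Hence the
    pair [k] splits into the pairs [k] and [k'] of the finer mesh. *)
Lemma kern_pair_double (c : R -> R) (kappa : R) (N k : nat) :
  cos_like c kappa -> (k < N)%nat ->
  let h := PI / (6 * INR (2 * N)) in
  kern_pair (c (2 * h)) (2 * h) k
    = / 2 * (kern_pair (c h) h k + kern_pair (c h) h (2 * N - 1 - k)).
Proof.
intros Hc Hk h.
destruct (cl_sep _ _ Hc N k Hk) as [H1 H2].
assert (HN : 0 < INR N) by (apply lt_0_INR; lia).
assert (Eh : 2 * h = PI / (6 * INR N)).
{ unfold h. rewrite mult_INR. simpl INR. field. lra. }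
rewrite <- Eh, (cl_double _ _ Hc) in H1, H2.
rewrite (cl_double _ _ Hc). unfold kern_pair.
replace (INR (6 * k + 1) * (2 * h)) with (2 * (INR (6 * k + 1) * h)) in * by ring.
replace (INR (6 * k + 5) * (2 * h)) with (2 * (INR (6 * k + 5) * h)) in * by ring.
rewrite !kern_double by easy.
assert (E : PI = INR (12 * N) * h).
{ unfold h. rewrite !mult_INR. simpl INR. field. lra. }
replace (PI - INR (6 * k + 1) * h) with (INR (6 * (2 * N - 1 - k) + 5) * h).
2:{ rewrite E at 1. rewrite <- Rmult_minus_distr_r, <- minus_INR by lia. do 2 f_equal; lia. }
replace (PI - INR (6 * k + 5) * h) with (INR (6 * (2 * N - 1 - k) + 1) * h).
2:{ rewrite E at 1. rewrite <- Rmult_minus_distr_r, <- minus_INR by lia. do 2 f_equal; lia. }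
ring.
Qed.

Definition mesh (j : nat) : R := PI / (6 * INR (2 ^ j)).

Lemma mesh_S (j : nat) : 2 * mesh (S j) = mesh j.
Proof.
unfold mesh. rewrite Nat.pow_succ_r', mult_INR. simpl (INR 2).
assert (0 < INR (2 ^ j)) by (apply lt_0_INR; pose proof (Nat.pow_nonzero 2 j); lia).
field. lra.
Qed.

(** The sum is unchanged by halving the mesh, since the pairs [k] and
    [2 * 2^j - 1 - k] with [k < 2^j] exhaust the finer index range.  At
    [j = 0] it is a last instance of duplication, from [PI / 6] to [PI / 3]. *)
Lemma kern_pair_sum (c : R -> R) (kappa : R) (j : nat) :
  cos_like c kappa ->
  mesh j * Rsum (kern_pair (c (mesh j)) (mesh j)) (2 ^ j)
    = PI / sqrt 3 / (2 * c (PI / 3) - 1).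
Proof.
intros Hc. induction j as [|j IH].
- assert (E : 2 * mesh 0 = PI / 3) by (unfold mesh; simpl; field).
  destruct (cl_sep _ _ Hc 1 0 ltac:(lia)) as [H1 H2].
  assert (E1 : mesh 0 = PI / 6) by (unfold mesh; simpl; field).
  replace (PI / (6 * INR 1)) with (mesh 0) in H1, H2 by (unfold mesh; easy).
  rewrite <- E, (cl_double _ _ Hc), E1 in *.
  simpl Rsum. unfold kern_pair, kern. simpl INR.
  replace ((1 + 1 + 1 + 1 + 1) * (PI / 6)) with (PI - PI / 6) by field.
  simpl INR in H2.
  replace ((1 + 1 + 1 + 1 + 1) * (PI / 6)) with (PI - PI / 6) in H2 by field.
  rewrite Rtrigo_facts.cos_pi_minus, Rtrigo_facts.sin_pi_minus in *.
  rewrite !Rmult_1_l in *. rewrite sin_PI6, cos_PI6 in *.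
  assert (S3 : sqrt 3 * sqrt 3 = 3) by (apply sqrt_sqrt; lra).
  assert (0 < sqrt 3) by (apply sqrt_lt_R0; lra).
  assert (N1 : c (PI / 6) - sqrt 3 / 2 <> 0) by lra.
  assert (N2 : c (PI / 6) + sqrt 3 / 2 <> 0) by lra.
  replace (2 * (2 * c (PI / 6) ^ 2 - 1) - 1)
    with (4 * ((c (PI / 6) - sqrt 3 / 2) * (c (PI / 6) + sqrt 3 / 2))) by nra.
  set (u := c (PI / 6)) in *.
  apply (Rmult_eq_reg_l (sqrt 3)); [|lra].
  transitivity (PI / 12 * (sqrt 3 * sqrt 3) / ((u - sqrt 3 / 2) * (u + sqrt 3 / 2))).
  + field. repeat split; lra.
  + rewrite S3. field. repeat split; lra.
- rewrite <- IH, <- (mesh_S j), Nat.pow_succ_r', Rsum_fold.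
  rewrite (Rsum_ext (kern_pair (c (2 * mesh (S j))) (2 * mesh (S j))) (fun k => / 2 *
     (kern_pair (c (mesh (S j))) (mesh (S j)) k
     + kern_pair (c (mesh (S j))) (mesh (S j)) (2 * 2 ^ j - 1 - k)))).
  + rewrite Rsum_scal. field.
  + intros k Hk. unfold mesh. rewrite Nat.pow_succ_r'.
    apply (kern_pair_double c kappa); easy.
Qed.
(** * Bounds uniform in the mesh *)

(** From [x - x^3 / 6 <= sin x] and [x^2 <= 4]. *)
Lemma sin_lower (x : R) : 0 <= x <= 2 -> x / 3 <= sin x.
Proof.
intros Hx.
destruct (pre_sin_bound x 0 ltac:(lra) ltac:(lra)) as [H _].
unfold sin_approx, sin_term in H. simpl in H. 
assert (x * (x * (x * 1)) / 6 <= 4 / 6 * x) by nra. lra.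
Qed.

Lemma one_minus_cos_lower (t : R) : 0 <= t <= PI -> t ^ 2 / 18 <= 1 - cos t.
Proof.
intros Ht. pose proof PI_4.
assert (Hs := sin_lower (t / 2) ltac:(lra)).
replace (cos t) with (1 - 2 * sin (t / 2) * sin (t / 2)).
- nra.
- rewrite <- cos_2a_sin. f_equal. lra.
Qed.

(** The derivative of the kernel is [(c cos t - 1) / (c - cos t)^2].  The
    hypothesis on [c] gives [1 - c <= (1 - cos t) / 2] on the interval; then
    the numerator is at most three times [c - cos t], which is itself at least
    of order [p^2]. *)
Lemma kern_diff_bound (c p q : R) :
  0 < p < q -> q < PI -> 1 - c <= p ^ 2 / 36 ->
  Rabs (kern c q - kern c p) <= 108 / p ^ 2 * (q - p).
Proof.
intros Hp Hq Hc.
assert (Hden : forall t, p <= t <= q ->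
  p ^ 2 / 36 <= (1 - cos t) / 2 <= c - cos t).
{ intros t Ht.
  assert (H := one_minus_cos_lower t ltac:(lra)).
  assert (p ^ 2 <= t ^ 2) by nra. lra. }
assert (0 < p ^ 2) by nra.
destruct (MVT_cor2 (kern c) (fun t => (c * cos t - 1) / (c - cos t) ^ 2) p q)
  as (t & -> & Ht).
- easy.
- intros t Ht. apply is_derive_Reals. unfold kern.
  assert (H1 := Hden t Ht).
  auto_derive; [lra|].
  assert (E := sin2_cos2 t). unfold Rsqr in E.
  transitivity ((cos t * (c - cos t) - sin t * sin t) / (c - cos t) ^ 2).
  + field. lra.
  + f_equal. lra.
- rewrite Rabs_mult, (Rabs_pos_eq (q - p)) by lra.
  apply Rmult_le_compat_r; [lra|].
  assert (H1 := Hden t ltac:(lra)).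
  assert (H2 := COS_bound t).
  unfold Rdiv at 1. rewrite Rabs_mult, Rabs_inv, (Rabs_pos_eq (_ ^ 2)) by nra.
  set (d := c - cos t) in *.
  assert (Rabs (c * cos t - 1) <= 3 * d).
  { apply Rabs_le. unfold d in *. split; nra. }
  apply Rle_trans with (3 * d * / d ^ 2).
  + apply Rmult_le_compat_r; [|easy]. apply Rlt_le, Rinv_0_lt_compat. nra.
  + replace (3 * d * / d ^ 2) with (3 / d) by (field; lra).
    replace (108 / p ^ 2) with (3 / (p ^ 2 / 36)) by (field; lra).
    apply Rmult_le_compat_l; [lra|]. apply Rinv_le_contravar; lra.
Qed.

Lemma mesh_pos (j : nat) : 0 < mesh j.
Proof.
unfold mesh. pose proof PI_RGT_0.
assert (0 < INR (2 ^ j)) by (apply lt_0_INR; pose proof (Nat.pow_nonzero 2 j); lia).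
apply Rdiv_lt_0_compat; lra.
Qed.

Lemma mesh_PI (j : nat) : 6 * INR (2 ^ j) * mesh j = PI.
Proof.
unfold mesh.
assert (0 < INR (2 ^ j)) by (apply lt_0_INR; pose proof (Nat.pow_nonzero 2 j); lia).
field. lra.
Qed.

(** The restriction [2 <= k] makes the angle [(6k+1) h] at least [13 h], hence
    [p^2 / 36 >= 169 h^2 / 36 >= 9 h^2 / 2 >= 1 - c h] as required by
    [kern_diff_bound]. *)
Lemma kern_pair_bound (c : R -> R) (kappa : R) (j k : nat) :
  cos_like c kappa -> (2 <= k < 2 ^ j)%nat ->
  Rabs (mesh j * kern_pair (c (mesh j)) (mesh j) k) <= 12 / INR k ^ 2.
Proof.
intros Hc [Hk Hkj].
assert (Hh := mesh_pos j). assert (HP := mesh_PI j). pose proof PI_RGT_0.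
set (h := mesh j) in *.
assert (Hk2 : 2 <= INR k) by (apply (le_INR 2); easy).
assert (Hkn : INR k + 1 <= INR (2 ^ j)).
{ rewrite <- S_INR. apply le_INR. lia. }
unfold kern_pair.
replace (INR (6 * k + 1)) with (6 * INR k + 1)
  by (rewrite plus_INR, mult_INR; simpl; ring).
replace (INR (6 * k + 5)) with (6 * INR k + 5)
  by (rewrite plus_INR, mult_INR; simpl; ring).
set (x := INR k) in *. set (n := INR (2 ^ j)) in *.
assert (Hl := cl_low _ _ Hc h Hh).
rewrite Rabs_mult, (Rabs_pos_eq h), Rabs_minus_sym by lra.
assert (H1 := kern_diff_bound (c h) ((6 * x + 1) * h)
  ((6 * x + 5) * h)).
assert (Hx : 36 * x ^ 2 * h ^ 2 <= ((6 * x + 1) * h) ^ 2) by nra.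
specialize (H1 ltac:(nra) ltac:(nra)).
assert (H169 : 162 * h ^ 2 <= ((6 * x + 1) * h) ^ 2) by nra.
specialize (H1 ltac:(lra)).
eapply Rle_trans; [apply Rmult_le_compat_l; [lra|exact H1]|].
set (p := (6 * x + 1) * h) in *.
assert (0 < 36 * x ^ 2 * h ^ 2) by (apply Rmult_lt_0_compat; nra).
apply Rle_trans with (h * (108 / (36 * x ^ 2 * h ^ 2) * (4 * h))).
- apply Rmult_le_compat_l; [lra|]. apply Rmult_le_compat; try lra.
  + apply Rlt_le, Rdiv_lt_0_compat; lra.
  + unfold p. lra.
  + apply Rmult_le_compat_l; [lra|]. apply Rinv_le_contravar; lra.
  + unfold p. lra.
- apply Req_le. field. lra.
Qed.

(** * Refining the mesh *)

Lemma mesh_lim : is_lim_seq mesh 0.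
Proof.
apply (is_lim_seq_ext (fun j => PI / 6 * (/ 2) ^ j)).
- intros j. unfold mesh. rewrite pow_INR, pow_inv. simpl (INR 2).
  assert (0 < (1 + 1) ^ j) by (apply pow_lt; lra).
  replace 2 with (1 + 1) by ring. field. lra.
- replace (Finite 0) with (Rbar_mult (PI / 6) 0) by (simpl; f_equal; ring).
  apply is_lim_seq_scal_l, is_lim_seq_geom.
  rewrite Rabs_pos_eq; lra.
Qed.

Lemma is_lim_quot (f : R -> R) (l : R) :
  f 0 = 0 -> is_derive f 0 l -> is_lim (fun h => f h / h) 0 l.
Proof.
intros H0 H. apply is_lim_spec. intros eps.
apply is_derive_Reals in H. destruct (H eps (cond_pos eps)) as [d Hd].
exists d. intros y Hy Hy0.
assert (E : Rabs (y - 0) < d) by exact Hy. rewrite Rminus_0_r in E.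
specialize (Hd y Hy0 E). rewrite Rplus_0_l, H0, Rminus_0_r in Hd. exact Hd.
Qed.

Lemma one_minus_cos_quot (m : R) :
  is_lim (fun h => (1 - cos (m * h)) / h ^ 2) 0 (m ^ 2 / 2).
Proof.
apply (is_lim_ext_loc (fun h => 2 * (sin (m / 2 * h) / h * (sin (m / 2 * h) / h)))).
- exists (mkposreal 1 Rlt_0_1). intros h _ Hh.
  replace (m * h) with (2 * (m / 2 * h)) by field.
  rewrite cos_2a_sin. field. easy.
- replace (m ^ 2 / 2) with (2 * (m / 2 * (m / 2))) by field.
  assert (H : is_lim (fun h => sin (m / 2 * h) / h) 0 (m / 2)).
  { apply (is_lim_quot (fun h => sin (m / 2 * h))).
    - rewrite Rmult_0_r. apply sin_0.
    - auto_derive; [easy|]. rewrite Rmult_0_r, cos_0. field. }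
  apply (is_lim_scal_l _ 2 0 (m / 2 * (m / 2))).
  apply (is_lim_mult _ _ 0 (m / 2) (m / 2)); easy.
Qed.

(** Dividing by [h^2], the denominator [c h - cos (m h)] tends to
    [kappa / 2 + m^2 / 2], and [sin (m h) / h] tends to [m]. *)
Lemma kern_lim (c : R -> R) (kappa m : R) :
  is_lim (fun h => (1 - c h) / h ^ 2) 0 (- (kappa / 2)) ->
  m ^ 2 + kappa <> 0 ->
  is_lim_seq (fun j => mesh j * kern (c (mesh j)) (m * mesh j))
    (2 * m / (m ^ 2 + kappa)).
Proof.
intros Hc Hm.
apply (is_lim_comp_seq (fun h => h * kern (c h) (m * h)) mesh 0).
- apply (is_lim_ext_loc (fun h => sin (m * h) / h /
    ((1 - cos (m * h)) / h ^ 2 - (1 - c h) / h ^ 2))).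
  + exists (mkposreal 1 Rlt_0_1). intros h _ Hh.
    unfold kern.
    replace ((1 - cos (m * h)) / h ^ 2 - (1 - c h) / h ^ 2)
      with ((c h - cos (m * h)) / h ^ 2) by (field; easy).
    unfold Rdiv. rewrite Rinv_mult, Rinv_inv.
    replace (sin (m * h) * / h * (/ (c h - cos (m * h)) * h ^ 2))
      with (h * / h * (h * (sin (m * h) * / (c h - cos (m * h))))) by ring.
    rewrite Rinv_r by easy. ring.
  + replace (2 * m / (m ^ 2 + kappa)) with (m / (m ^ 2 / 2 - - (kappa / 2)))
      by (field; repeat split; lra).
    apply (is_lim_div _ _ 0 m (m ^ 2 / 2 - - (kappa / 2))).
    * apply (is_lim_quot (fun h => sin (m * h))).
      -- rewrite Rmult_0_r. apply sin_0.
      -- auto_derive; [easy|]. rewrite Rmult_0_r, cos_0. field.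
    * apply (is_lim_minus' _ _ 0); [apply one_minus_cos_quot|easy].
    * intro E. injection E. lra.
    * easy.
- exists O. intros j _ E. injection E. pose proof (mesh_pos j). lra.
- apply mesh_lim.
Qed.

Definition fraction_pair (kappa : R) (k : nat) : R :=
  2 * INR (6 * k + 1) / (INR (6 * k + 1) ^ 2 + kappa)
  - 2 * INR (6 * k + 5) / (INR (6 * k + 5) ^ 2 + kappa).

(** The partial fraction expansion of [1 / (2 c(PI/3) - 1)], with an error that
    is uniform in [c].  On each mesh the full sum is the closed form, so the sum
    of the first [K] pairs misses it by a tail bounded by [kern_pair_bound];
    this survives the limit [j -> oo] for fixed [K]. *)
Lemma fraction_sum (c : R -> R) (kappa : R) (K : nat) :
  cos_like c kappa -> (2 <= K)%nat ->
  Rabs (Rsum (fraction_pair kappa) K - PI / sqrt 3 / (2 * c (PI / 3) - 1))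
    <= 12 / (INR K - 1).
Proof.
intros Hc HK.
set (L := PI / sqrt 3 / (2 * c (PI / 3) - 1)).
assert (HK' : 2 <= INR K) by (apply (le_INR 2); easy).
set (a := fun j k => mesh j * kern_pair (c (mesh j)) (mesh j) k).
assert (Ha : is_lim_seq (fun j => Rsum (a j) K) (Rsum (fraction_pair kappa) K)).
{ apply Rsum_lim. intros k _. destruct (cl_pole _ _ Hc k) as [H1 H5].
  assert (L1 := kern_lim c kappa _ (cl_lim _ _ Hc) H1).
  assert (L5 := kern_lim c kappa _ (cl_lim _ _ Hc) H5).
  eapply is_lim_seq_ext; [|apply (is_lim_seq_minus' _ _ _ _ L1 L5)].
  intros j. unfold a, kern_pair. simpl. ring. }
assert (Hd : is_lim_seq (fun j => Rabs (Rsum (a j) K - L)) (Rabs (Rsum (fraction_pair kappa) K - L))).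
{ apply (is_lim_seq_abs _ (Finite _)).
  apply is_lim_seq_minus'; [easy|apply is_lim_seq_const]. }
refine (is_lim_seq_le_loc (fun j => Rabs (Rsum (a j) K - L))
  (fun _ => 12 / (INR K - 1)) (Finite _) (Finite _) _ Hd (is_lim_seq_const _)).
exists K. intros j Hj.
assert (HKj : (K <= 2 ^ j)%nat).
{ pose proof (Nat.pow_gt_lin_r 2 j ltac:(lia)). lia. }
assert (HN : 2 <= INR (2 ^ j)) by (apply (le_INR 2); lia).
replace L with (Rsum (a j) (2 ^ j)).
- rewrite Rabs_minus_sym.
  eapply Rle_trans; [apply (Rsum_tail (a j) 12); [lia| |lra]|].
  + intros k Hk. apply (kern_pair_bound c kappa); [easy|lia].
  + assert (0 < 12 / (INR (2 ^ j) - 1)) by (apply Rdiv_lt_0_compat; lra). lra.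
- unfold a, L. rewrite Rsum_scal. apply (kern_pair_sum c kappa j Hc).
Qed.
(** * The hyperbolic and the circular instance *)

Lemma sinh_cosh_sq (x : R) : cosh x ^ 2 - sinh x ^ 2 = 1.
Proof.
unfold cosh, sinh.
assert (exp x * exp (- x) = 1) by (rewrite <- exp_plus, Rplus_opp_r; apply exp_0).
nra.
Qed.

Lemma cosh_ge_1 (x : R) : 1 <= cosh x.
Proof.
assert (H := sinh_cosh_sq x).
assert (0 < cosh x) by (unfold cosh; pose proof (exp_pos x); pose proof (exp_pos (- x)); lra).
nra.
Qed.
Lemma cosh_double (x : R) : cosh (2 * x) = 2 * cosh x ^ 2 - 1.
Proof.
unfold cosh.
replace (- (2 * x)) with (- x + - x) by ring. replace (2 * x) with (x + x) by ring.
rewrite !exp_plus.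
assert (exp x * exp (- x) = 1) by (rewrite <- exp_plus, Rplus_opp_r; apply exp_0).
nra.
Qed.

Lemma mesh_angle (N k r : nat) :
  (k < N)%nat -> (1 <= r <= 5)%nat ->
  0 < INR (6 * k + r) * (PI / (6 * INR N)) < PI.
Proof.
intros Hk Hr. pose proof PI_RGT_0.
assert (HN : 0 < INR N) by (apply lt_0_INR; lia).
assert (H1 : 1 <= INR (6 * k + r)) by (apply (le_INR 1); lia).
assert (H2 : INR (6 * k + r) < 6 * INR N).
{ replace (6 * INR N) with (INR (6 * N)) by (rewrite mult_INR; simpl; ring).
  apply lt_INR; lia. }
assert (0 < PI / (6 * INR N)) by (apply Rdiv_lt_0_compat; lra).
split; [nra|].
apply Rlt_le_trans with (6 * INR N * (PI / (6 * INR N))).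
- apply Rmult_lt_compat_r; easy.
- apply Req_le. field. lra.
Qed.

Lemma cos_like_cosh (s : R) : cos_like (fun h => cosh (s * h)) (s ^ 2).
Proof.
split.
- intros h. rewrite <- cosh_double. f_equal. ring.
- apply (is_lim_ext_loc (fun h => -2 * (sinh (s / 2 * h) / h * (sinh (s / 2 * h) / h)))).
  + exists (mkposreal 1 Rlt_0_1). intros h _ Hh.
    replace (s * h) with (2 * (s / 2 * h)) by field.
    rewrite cosh_double. pose proof (sinh_cosh_sq (s / 2 * h)) as E.
    replace (cosh (s / 2 * h) ^ 2) with (1 + sinh (s / 2 * h) ^ 2) by lra.
    field. easy.
  + replace (- (s ^ 2 / 2)) with (-2 * (s / 2 * (s / 2))) by field.
    assert (H : is_lim (fun h => sinh (s / 2 * h) / h) 0 (s / 2)).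
    { apply (is_lim_quot (fun h => sinh (s / 2 * h))).
      - rewrite Rmult_0_r. apply sinh_0.
      - auto_derive; [easy|]. rewrite Rmult_0_r, cosh_0. field. }
    apply (is_lim_scal_l _ (-2) 0 (s / 2 * (s / 2))).
    apply (is_lim_mult _ _ 0 (s / 2) (s / 2)); easy.
- intros h _. pose proof (cosh_ge_1 (s * h)). nra.
- intros N k Hk. set (h := PI / (6 * INR N)).
  assert (H : forall t, 0 < t < PI -> cosh (s * h) <> cos t).
  { intros t Ht. pose proof (cosh_ge_1 (s * h)).
    assert (cos t < cos 0) by (apply cos_decreasing_1; lra).
    rewrite cos_0 in *. lra. }
  split; apply H, mesh_angle; lia.
- intros k. split; apply Rgt_not_eq.
  + assert (1 <= INR (6 * k + 1)) by (apply (le_INR 1); lia). nra.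
  + assert (1 <= INR (6 * k + 5)) by (apply (le_INR 1); lia). nra.
Qed.

Lemma one_minus_cos_upper (t : R) : 0 < t -> 1 - cos t <= t ^ 2 / 2.
Proof.
intros Ht.
replace (cos t) with (1 - 2 * sin (t / 2) * sin (t / 2)).
2:{ rewrite <- cos_2a_sin. f_equal. lra. }
assert (sin (t / 2) < t / 2) by (apply sin_lt_x; lra).
assert (- (t / 2) <= sin (t / 2)).
{ destruct (Rle_lt_dec (t / 2) PI) as [H1|H1].
  - assert (0 <= sin (t / 2)) by (apply sin_ge_0; lra). lra.
  - pose proof (SIN_bound (t / 2)). pose proof PI2_3_2. lra. }
nra.
Qed.

(** The interval [(1, 3)] contains no number congruent to 1 or 5 modulo 6. *)
Lemma residue_sep (x : R) (k r : nat) :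
  1 < x < 3 -> r = 1%nat \/ r = 5%nat -> INR (6 * k + r) <> x.
Proof.
intros Hx Hr E.
destruct (Nat.le_gt_cases (6 * k + r) 1) as [H|H].
- apply le_INR in H. simpl (INR 1) in H. lra.
- assert (H3 : (3 <= 6 * k + r)%nat) by lia.
  apply le_INR in H3. simpl (INR 3) in H3. lra.
Qed.

Lemma cos_like_cos (x : R) :
  1 < x < 3 -> cos_like (fun h => cos (x * h)) (- x ^ 2).
Proof.
intros Hx. split.
- intros h. replace (x * (2 * h)) with (2 * (x * h)) by ring.
  rewrite cos_2a_cos. ring.
- replace (- (- x ^ 2 / 2)) with (x ^ 2 / 2) by field. apply one_minus_cos_quot.
- intros h Hh.
  apply Rle_trans with ((x * h) ^ 2 / 2).
  + apply one_minus_cos_upper. nra.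
  + assert (x ^ 2 <= 9) by nra. assert (0 <= h ^ 2) by nra. nra.
- intros N k Hk.
  assert (HN : 1 <= INR N) by (apply (le_INR 1); lia).
  assert (Hh : 0 < PI / (6 * INR N)).
  { pose proof PI_RGT_0. apply Rdiv_lt_0_compat; lra. }
  assert (H3 : PI / (6 * INR N) * 3 <= PI).
  { apply (Rmult_le_reg_r (6 * INR N)); [lra|]. pose proof PI_RGT_0.
    replace (PI / (6 * INR N) * 3 * (6 * INR N)) with (3 * PI) by (field; lra). nra. }
  assert (H : forall r, r = 1%nat \/ r = 5%nat ->
    cos (x * (PI / (6 * INR N))) <> cos (INR (6 * k + r) * (PI / (6 * INR N)))).
  { intros r Hr E.
    assert (Ha := mesh_angle N k r Hk ltac:(lia)).
    apply cos_inj in E; [|split; nra|lra].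
    apply Rmult_eq_reg_r in E; [|lra]. symmetry in E. revert E.
    apply residue_sep; easy. }
  split; apply H; auto.
- intros k.
  assert (H : forall r, r = 1%nat \/ r = 5%nat -> INR (6 * k + r) ^ 2 + - x ^ 2 <> 0).
  { intros r Hr E. pose proof (pos_INR (6 * k + r)).
    apply (residue_sep x k r Hx Hr). nra. }
  split; apply H; auto.
Qed.

(** * The curve *)

(** Solving the relation for [beta] gives an arctangent of
    [1 / (sqrt 3 * tanh (PI s / 6))]; replacing it by the complementary angle
    makes the formula smooth at [s = 0], where [beta = 3]. *)
Definition curve (s : R) : R := 3 - 6 / PI * atan (sqrt 3 * tanh (PI * s / 6)).

(** The derivative of [curve]. *)
Definition slope (s : R) : R := - (sqrt 3 / (2 * cosh (PI * s / 3) - 1)).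

Lemma sqrt3_sq : sqrt 3 * sqrt 3 = 3.
Proof. apply sqrt_sqrt; lra. Qed.

Lemma cosh_third (s : R) :
  2 * cosh (PI * s / 3) - 1 = cosh (PI * s / 6) ^ 2 + 3 * sinh (PI * s / 6) ^ 2.
Proof.
replace (PI * s / 3) with (2 * (PI * s / 6)) by field.
rewrite cosh_double. pose proof (sinh_cosh_sq (PI * s / 6)). lra.
Qed.

Lemma curve_derive (s : R) : is_derive curve s (slope s).
Proof.
unfold curve, slope. rewrite cosh_third. unfold tanh.
pose proof (cosh_ge_1 (PI * s / 6)) as Hc. pose proof PI_RGT_0.
auto_derive; unfold Rdiv in *.
- lra.
- pose proof (sinh_cosh_sq (PI * s * / 6)) as E.
  set (C := cosh (PI * s * / 6)) in *. set (S := sinh (PI * s * / 6)) in *.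
  assert (S3 := sqrt3_sq).
  replace (sqrt 3 * (S * / C) * (sqrt 3 * (S * / C) * 1))
    with (sqrt 3 * sqrt 3 * S ^ 2 * / C ^ 2) by (field; lra).
  replace (PI * 1 * / 6 * C * / C + S * (- (PI * 1 * / 6 * S) * / (C * C)))
    with (PI * / 6 * (C ^ 2 - S ^ 2) * / C ^ 2) by (field; lra).
  rewrite S3, E. field. nra.
Qed.

Lemma curve_0 : curve 0 = 3.
Proof.
unfold curve, tanh. replace (PI * 0 / 6) with 0 by field.
rewrite sinh_0. unfold Rdiv. rewrite Rmult_0_l, Rmult_0_r, atan_0. ring.
Qed.

Lemma tanh_bounds (x : R) : 0 < x -> 0 < tanh x < 1.
Proof.
intros Hx. unfold tanh.
assert (0 < sinh x) by (rewrite <- sinh_0; apply sinh_lt; easy).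
pose proof (cosh_ge_1 x). pose proof (sinh_cosh_sq x).
split.
- apply Rdiv_lt_0_compat; lra.
- apply (Rmult_lt_reg_r (cosh x)); [lra|]. unfold Rdiv.
  rewrite Rmult_assoc, Rinv_l by lra. nra.
Qed.

Lemma curve_bounds (s : R) : 0 < s -> 1 < curve s < 3.
Proof.
intros Hs. pose proof PI_RGT_0.
assert (HT := tanh_bounds (PI * s / 6) ltac:(nra)).
assert (0 < sqrt 3) by (apply sqrt_lt_R0; lra).
set (T := tanh (PI * s / 6)) in *.
assert (Hp : 0 < atan (sqrt 3 * T)).
{ rewrite <- atan_0. apply atan_increasing. nra. }
assert (H3 : atan (sqrt 3 * T) < PI / 3).
{ rewrite <- (atan_tan (PI / 3)), tan_PI3 by lra. apply atan_increasing. nra. }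
unfold curve. fold T.
assert (E : PI * (6 / PI * atan (sqrt 3 * T)) = 6 * atan (sqrt 3 * T)) by (field; lra).
split; nra.
Qed.

(** [curve s * (PI / 3)] is [PI - 2 p] with [tan p = sqrt 3 * tanh (PI s / 6)],
    so its cosine is rational in that tangent. *)
Lemma curve_cos (s : R) :
  2 * cos (curve s * (PI / 3)) - 1 = - 3 / (2 * cosh (PI * s / 3) - 1).
Proof.
rewrite cosh_third. pose proof PI_RGT_0.
set (p := atan (sqrt 3 * tanh (PI * s / 6))).
replace (curve s * (PI / 3)) with (PI - 2 * p) by (unfold curve; fold p; field; lra).
rewrite Rtrigo_facts.cos_pi_minus, cos_2a_cos.
assert (Hp : 0 < cos p) by (pose proof (atan_bound (sqrt 3 * tanh (PI * s / 6)));
  apply cos_gt_0; unfold p; lra).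
assert (Ht : sin p = sqrt 3 * tanh (PI * s / 6) * cos p).
{ unfold p at 1. rewrite <- (tan_atan (sqrt 3 * tanh (PI * s / 6))) at 2. fold p.
  unfold tan. field. lra. }
assert (E := sin2_cos2 p). unfold Rsqr in E. rewrite Ht in E.
unfold tanh in E.
pose proof (cosh_ge_1 (PI * s / 6)).
pose proof (sinh_cosh_sq (PI * s / 6)) as E2.
set (C := cosh (PI * s / 6)) in *. set (S := sinh (PI * s / 6)) in *.
assert (E' : cos p * cos p * (C ^ 2 + sqrt 3 * sqrt 3 * S ^ 2) = C ^ 2).
{ transitivity (C ^ 2 * 1); [rewrite <- E|]; field. lra. }
rewrite sqrt3_sq in E'.
apply (Rmult_eq_reg_r (C ^ 2 + 3 * S ^ 2)); [|nra].
replace (- 3 / (C ^ 2 + 3 * S ^ 2) * (C ^ 2 + 3 * S ^ 2)) with (- 3) by (field; nra).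
lra.
Qed.

Lemma curve_unique (a b : R) :
  0 < a -> 1 < b < 3 ->
  tanh (PI * a / 6) * tan (PI * b / 6) = 1 / sqrt 3 -> b = curve a.
Proof.
intros Ha Hb E. pose proof PI_RGT_0.
assert (0 < sqrt 3) by (apply sqrt_lt_R0; lra).
assert (HT := tanh_bounds (PI * a / 6) ltac:(nra)).
assert (Hc : 0 < cos (PI * b / 6)) by (apply cos_gt_0; nra).
assert (Hs : 0 < sin (PI * b / 6)) by (apply sin_gt_0; nra).
unfold curve.
replace (sqrt 3 * tanh (PI * a / 6)) with (tan (PI / 2 - PI * b / 6)).
- rewrite atan_tan by nra. field. lra.
- set (T := tanh (PI * a / 6)) in *. 
  unfold tan in *. rewrite sin_shift, cos_shift.
  set (S := sin (PI * b / 6)) in *. set (C := cos (PI * b / 6)) in *.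
  assert (E1 : T * S * sqrt 3 = C).
  { transitivity (T * (S / C) * sqrt 3 * C); [field; lra|rewrite E; field; lra]. }
  rewrite <- E1. field. lra.
Qed.

(** * Differentiating along the curve *)

Definition logfactor (a b : R) (n : nat) : R :=
  INR n * ln (((INR n ^ 2 + a ^ 2) * (INR n ^ 2 - b ^ 2))
       / (INR n ^ 2 * (INR n ^ 2 - 9))).

(** For [x = 1] both [x^2 - b^2] and [x^2 - 9] are negative; from [x = 5] on both
    are positive. *)
Lemma ratio_pos (a b x : R) :
  x = 1 \/ 5 <= x -> 1 < b <= 3 ->
  0 < ((x ^ 2 + a ^ 2) * (x ^ 2 - b ^ 2)) / (x ^ 2 * (x ^ 2 - 9)).
Proof.
intros Hx Hb.
assert (Hq : 0 < (x ^ 2 - b ^ 2) / (x ^ 2 - 9)).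
{ destruct Hx as [->|Hx].
  - replace ((1 ^ 2 - b ^ 2) / (1 ^ 2 - 9)) with ((b ^ 2 - 1) / 8) by field. nra.
  - apply Rdiv_lt_0_compat; nra. }
assert (x ^ 2 - 9 <> 0) by (destruct Hx as [->|Hx]; nra).
replace (((x ^ 2 + a ^ 2) * (x ^ 2 - b ^ 2)) / (x ^ 2 * (x ^ 2 - 9)))
  with ((x ^ 2 + a ^ 2) / x ^ 2 * ((x ^ 2 - b ^ 2) / (x ^ 2 - 9))).
- apply Rmult_lt_0_compat; [apply Rdiv_lt_0_compat|]; try easy; destruct Hx; nra.
- field. split; [easy|]. destruct Hx; lra.
Qed.

Lemma INR_residue (k r : nat) :
  r = 1%nat \/ r = 5%nat -> INR (6 * k + r) = 1 \/ 5 <= INR (6 * k + r).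
Proof.
intros Hr. destruct (Nat.eq_dec (6 * k + r) 1) as [->|H].
- left. easy.
- right. replace 5 with (INR 5) by (simpl; ring). apply le_INR. lia.
Qed.

Lemma curve_bounds_weak (s : R) : 0 <= s -> 1 < curve s <= 3.
Proof.
intros [Hs| <-]; [apply curve_bounds in Hs; lra|rewrite curve_0; lra].
Qed.

Lemma logfactor_derive (k r : nat) (s : R) :
  r = 1%nat \/ r = 5%nat -> 0 <= s ->
  let n := INR (6 * k + r) in
  is_derive (fun s => logfactor s (curve s) (6 * k + r)) s
    (s * (2 * n / (n ^ 2 + s ^ 2))
     - curve s * slope s * (2 * n / (n ^ 2 + - curve s ^ 2))).
Proof.
intros Hr Hs n. unfold logfactor. fold n.
assert (Hn : n = 1 \/ 5 <= n) by (apply INR_residue; easy).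
assert (Hb := curve_bounds_weak s Hs).
assert (H9 : n ^ 2 - 9 <> 0) by (destruct Hn as [->|]; nra).
assert (Hnb : n ^ 2 - curve s ^ 2 <> 0) by (destruct Hn as [->|]; nra).
assert (Hn0 : 0 < n) by (destruct Hn; lra).
assert (Hpos := ratio_pos s (curve s) n Hn Hb).
assert (Dc := curve_derive s).
assert (Dq : is_derive (fun s => ((n ^ 2 + s ^ 2) * (n ^ 2 - curve s ^ 2))
    / (n ^ 2 * (n ^ 2 - 9))) s
  ((2 * s * (n ^ 2 - curve s ^ 2) - (n ^ 2 + s ^ 2) * (2 * curve s * slope s))
    / (n ^ 2 * (n ^ 2 - 9)))).
{ auto_derive.
  - exists (slope s). easy.
  - replace (Derive (fun x => curve x) s) with (slope s)
      by (symmetry; apply is_derive_unique, Dc).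
    field. split; lra. }
assert (D := is_derive_comp ln _ s _ _ (is_derive_ln _ Hpos) Dq).
assert (D' := is_derive_scal _ s n _ D).
eapply is_derive_ext; [|replace (s * (2 * n / (n ^ 2 + s ^ 2))
     - curve s * slope s * (2 * n / (n ^ 2 + - curve s ^ 2)))
  with (n * scal ((2 * s * (n ^ 2 - curve s ^ 2) - (n ^ 2 + s ^ 2) * (2 * curve s * slope s))
    / (n ^ 2 * (n ^ 2 - 9))) (/ (((n ^ 2 + s ^ 2) * (n ^ 2 - curve s ^ 2))
    / (n ^ 2 * (n ^ 2 - 9))))); [exact D'|]].
- intros t. easy.
- unfold scal; simpl; unfold mult; simpl. field.
  repeat split; try easy; nra.
Qed.
Lemma Rsum_derive (f : nat -> R -> R) (df : nat -> R) (x : R) (n : nat) :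
  (forall k, is_derive (f k) x (df k)) ->
  is_derive (fun y => Rsum (fun k => f k y) n) x (Rsum df n).
Proof.
intros H. induction n as [|n IH]; simpl.
- apply (is_derive_const 0).
- apply (is_derive_plus (fun y => Rsum (fun k => f k y) n) (f n)); easy.
Qed.

Definition logpair (a b : R) (k : nat) : R :=
  logfactor a b (6 * k + 1) - logfactor a b (6 * k + 5).

(** The logarithm of the [6K]-th partial product at [(s, curve s)], minus the
    logarithm of the claimed limit. *)
Definition defect (K : nat) (s : R) : R :=
  Rsum (logpair s (curve s)) K + PI / 3 * (s * curve s).

Lemma defect_derive (K : nat) (s : R) :
  0 <= s ->
  is_derive (defect K) s
    (s * Rsum (fraction_pair (s ^ 2)) K
     - curve s * slope s * Rsum (fraction_pair (- curve s ^ 2)) K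
     + PI / 3 * (curve s + s * slope s)).
Proof.
intros Hs. unfold defect.
apply (is_derive_plus (fun s => Rsum (logpair s (curve s)) K)).
- replace (s * Rsum (fraction_pair (s ^ 2)) K
      - curve s * slope s * Rsum (fraction_pair (- curve s ^ 2)) K)
    with (Rsum (fun k => s * fraction_pair (s ^ 2) k
       + - (curve s * slope s) * fraction_pair (- curve s ^ 2) k) K)
    by (rewrite Rsum_plus, !Rsum_scal; ring).
  apply (Rsum_derive (fun k s => logpair s (curve s) k)). intros k.
  assert (D1 := logfactor_derive k 1 s (or_introl eq_refl) Hs).
  assert (D5 := logfactor_derive k 5 s (or_intror eq_refl) Hs).
  assert (D := is_derive_minus _ _ s _ _ D1 D5). cbv zeta in D.
  unfold fraction_pair.
  eapply is_derive_ext; [|match type of D with is_derive _ _ ?l =>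
    replace (s * _ + _) with l; [exact D|] end].
  + intros t. easy.
  + unfold minus, plus, opp; simpl. ring.
- apply is_derive_scal.
  assert (D := is_derive_mult (fun t => t) curve s 1 (slope s) (is_derive_id s)
    (curve_derive s) Rmult_comm).
  replace (curve s + s * slope s) with (plus (mult 1 (curve s)) (mult s (slope s))).
  + exact D.
  + unfold plus, mult; simpl. ring.
Qed.

(** Replacing the two sums by their closed forms makes the expression vanish;
    what remains are the two errors, with coefficients [s] and
    [curve s * |slope s| <= 3 * 2]. *)
Lemma defect_slope_bound (K : nat) (s : R) :
  (2 <= K)%nat -> 0 < s ->
  Rabs (s * Rsum (fraction_pair (s ^ 2)) K
     - curve s * slope s * Rsum (fraction_pair (- curve s ^ 2)) K
     + PI / 3 * (curve s + s * slope s)) <= (s + 6) * (12 / (INR K - 1)).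
Proof.
intros HK Hs.
assert (Hb := curve_bounds s Hs).
assert (H1 := fraction_sum _ _ K (cos_like_cosh s) HK).
assert (H2 := fraction_sum _ _ K (cos_like_cos (curve s) Hb) HK).
cbv beta in H1, H2. rewrite curve_cos in H2.
replace (s * (PI / 3)) with (PI * s / 3) in H1 by field.
assert (S3 := sqrt3_sq).
assert (Hq : 0 < sqrt 3) by (apply sqrt_lt_R0; lra).
assert (Hq2 : sqrt 3 <= 2) by nra.
pose proof (cosh_ge_1 (PI * s / 3)) as Hc.
unfold slope in *. set (g := 2 * cosh (PI * s / 3) - 1) in *.
set (X := Rsum (fraction_pair (s ^ 2)) K) in *.
set (Y := Rsum (fraction_pair (- curve s ^ 2)) K) in *.
set (b := curve s) in *. set (e := 12 / (INR K - 1)) in *.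
assert (Hsl : 0 < sqrt 3 / g <= 2).
{ split; [apply Rdiv_lt_0_compat; unfold g; lra|].
  apply (Rmult_le_reg_r g); [unfold g; lra|].
  replace (sqrt 3 / g * g) with (sqrt 3) by (field; unfold g; lra). unfold g; lra. }
replace (s * X - b * - (sqrt 3 / g) * Y + PI / 3 * (b + s * - (sqrt 3 / g)))
  with (s * (X - PI / sqrt 3 / g)
        + b * (sqrt 3 / g) * (Y - PI / sqrt 3 / (- 3 / g))).
- eapply Rle_trans; [apply Rabs_triang|].
  rewrite !Rabs_mult, (Rabs_pos_eq s), (Rabs_pos_eq b), (Rabs_pos_eq (sqrt 3 / g)) by lra.
  assert (b * (sqrt 3 / g) <= 6) by nra.
  assert (0 <= b * (sqrt 3 / g)) by nra.
  set (w := b * (sqrt 3 / g)) in *.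
  pose proof (Rabs_pos (X - PI / sqrt 3 / g)).
  pose proof (Rabs_pos (Y - PI / sqrt 3 / (- 3 / g))).
  nra.
- assert (E : PI / sqrt 3 = PI * sqrt 3 / 3).
  { apply (Rmult_eq_reg_r (sqrt 3)); [|lra].
    transitivity (PI * (sqrt 3 * sqrt 3) / 3); [rewrite S3; field; lra|field]. }
  rewrite !E.
  assert (Hg : g <> 0) by (unfold g; lra).
  replace (PI * sqrt 3 / 3 / (- 3 / g)) with (- (PI * sqrt 3 * g / 9)) by (field; easy).
  transitivity (s * X + b * (sqrt 3 / g) * Y - PI / 3 * s * (sqrt 3 / g)
    + PI / 9 * b * (sqrt 3 * sqrt 3)); [field; easy|rewrite S3; field; easy].
Qed.

Lemma defect_0 (K : nat) : defect K 0 = 0.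
Proof.
unfold defect. rewrite curve_0, Rmult_0_l, Rmult_0_r, Rplus_0_r.
assert (H : forall k r, r = 1%nat \/ r = 5%nat -> logfactor 0 3 (6 * k + r) = 0).
{ intros k r Hr. unfold logfactor.
  replace (_ / _) with 1; [rewrite ln_1; ring|].
  destruct (INR_residue k r Hr) as [->|Hn]; field; repeat split; nra. }
induction K as [|K IH]; simpl Rsum; [easy|].
rewrite IH. unfold logpair. rewrite !H by auto. ring.
Qed.

Lemma defect_lim (s : R) : 0 < s -> is_lim_seq (fun K => defect K s) 0.
Proof.
intros Hs. apply is_lim_seq_abs_0.
apply (is_lim_seq_le_le_loc (fun _ => 0) _ (fun K => s * (s + 6) * 12 * / (INR K - 1))).
- exists 2%nat. intros K HK. split; [apply Rabs_pos|].
  destruct (MVT_cor2 (defect K) (fun t => t * Rsum (fraction_pair (t ^ 2)) K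
     - curve t * slope t * Rsum (fraction_pair (- curve t ^ 2)) K
     + PI / 3 * (curve t + t * slope t)) 0 s Hs) as (t & E & Ht).
  + intros t Ht. apply is_derive_Reals, defect_derive. lra.
  + rewrite defect_0, !Rminus_0_r in E. rewrite E, Rabs_mult, (Rabs_pos_eq s) by lra.
    assert (HB := defect_slope_bound K t HK ltac:(lra)). cbv beta.
    assert (HK' : 2 <= INR K) by (apply (le_INR 2); easy).
    assert (0 < 12 / (INR K - 1)) by (apply Rdiv_lt_0_compat; lra).
    eapply Rle_trans; [apply Rmult_le_compat_r; [lra|exact HB]|].
    apply Rle_trans with ((s + 6) * (12 / (INR K - 1)) * s).
    { do 2 (apply Rmult_le_compat_r; [lra|]). lra. }
    apply Req_le. field. lra.
- apply is_lim_seq_const.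
- replace (Finite 0) with (Rbar_mult (s * (s + 6) * 12) 0) by (simpl; f_equal; ring).
  apply is_lim_seq_scal_l.
  replace (Finite 0) with (Rbar_inv p_infty) by easy.
  apply is_lim_seq_inv; [|easy].
  eapply is_lim_seq_minus; [apply is_lim_seq_INR|apply is_lim_seq_const|easy].
Qed.

(** In the variable [x = 1 / n] the term is [g x / x] with [g] even, smooth at 0
    and [g 0 = 0], so it tends to [g' 0 = 0]. *)
Lemma logfactor_lim (a b : R) : is_lim_seq (logfactor a b) 0.
Proof.
set (g := fun x => ln ((1 + a ^ 2 * x ^ 2) * (1 - b ^ 2 * x ^ 2) / (1 - 9 * x ^ 2))).
assert (Hg : is_lim (fun x => g x / x) 0 0).
{ apply is_lim_quot.
  - unfold g. transitivity (ln 1); [f_equal; field|apply ln_1].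
  - unfold g. auto_derive.
    + split; [lra|]. split; [|easy].
      rewrite !Rmult_0_l, !Rmult_0_r, Ropp_0, !Rplus_0_r. lra.
    + unfold Rdiv. ring. }
assert (Hinv : is_lim_seq (fun n => / INR n) 0).
{ replace (Finite 0) with (Rbar_inv p_infty) by easy.
  apply is_lim_seq_inv; [apply is_lim_seq_INR|easy]. }
apply (is_lim_seq_ext_loc (fun n => g (/ INR n) / / INR n)).
- exists 4%nat. intros n Hn. apply (le_INR 4) in Hn. simpl (INR 4) in Hn.
  unfold logfactor, g, Rdiv at 1. rewrite Rinv_inv, Rmult_comm. do 2 f_equal.
  field. repeat split; nra.
- apply (is_lim_comp_seq (fun x => g x / x) _ 0); [easy| |easy].
  exists 1%nat. intros n Hn. apply (le_INR 1) in Hn. simpl (INR 1) in Hn.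
  intro E. injection E. apply Rinv_neq_0_compat. lra.
Qed.

(** * Partial products *)

Lemma partial_product_S (a b : R) (n : nat) :
  partial_product a b (S n)
    = partial_product a b n * (if Nat.eqb (S n) 3 then 1 else factor a b (S n)).
Proof.
unfold partial_product. rewrite seq_S, filter_app, map_app, fold_right_app.
assert (H : forall l x, fold_right Rmult x l = fold_right Rmult 1 l * x).
{ intros l x. induction l as [|y l IH]; simpl; [ring|rewrite IH; ring]. }
rewrite H. f_equal. unfold filter. change (1 + n)%nat with (S n).
destruct (Nat.eqb (S n) 3); simpl; ring.
Qed.

Lemma chi6_residue (k r : nat) : chi6 (6 * k + r) = chi6 r.
Proof.
unfold chi6. replace (6 * k + r)%nat with (r + k * 6)%nat by lia.
rewrite Nat.Div0.mod_add. easy.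
Qed.

Lemma factor_trivial (a b : R) (k r : nat) :
  chi6 r = 0%Z -> factor a b (6 * k + r) = 1.
Proof. intros H. unfold factor. rewrite chi6_residue, H, Z.mul_0_r. easy. Qed.

Lemma factor_exp (a b : R) (k r : nat) :
  1 < b < 3 -> r = 1%nat \/ r = 5%nat ->
  factor a b (6 * k + r) = exp (IZR (chi6 r) * logfactor a b (6 * k + r)).
Proof.
intros Hb Hr. unfold factor, logfactor. rewrite chi6_residue.
rewrite powerRZ_Rpower by (apply ratio_pos; [apply INR_residue; easy|lra]).
unfold Rpower. f_equal. rewrite mult_IZR, <- INR_IZR_INZ. ring.
Qed.

(** The only nontrivial factor with index in [6k+1 .. 6k+4] is the first; for
    [k = 0] the excluded index 3 is among the trivial ones. *)
Lemma partial_product_residue_1 (a b : R) (k r : nat) :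
  1 < b < 3 -> (1 <= r <= 4)%nat ->
  partial_product a b (6 * k + r)
    = partial_product a b (6 * k) * exp (logfactor a b (6 * k + 1)).
Proof.
intros Hb Hr.
replace (logfactor a b (6 * k + 1)) with (IZR (chi6 1) * logfactor a b (6 * k + 1))
  by (change (chi6 1) with 1%Z; ring).
rewrite <- factor_exp by auto.
assert (H : forall m, (1 <= m <= 3)%nat -> partial_product a b (6 * k + S m)
    = partial_product a b (6 * k + m)).
{ intros m Hm. rewrite Nat.add_succ_r, partial_product_S, <- Nat.add_succ_r.
  destruct (Nat.eqb _ _); [ring|].
  rewrite factor_trivial; [ring|].
  destruct Hm as [H1 H3]. destruct m as [|[|[|[|m]]]]; try easy; lia. }
assert (H1 : partial_product a b (6 * k + 1)
    = partial_product a b (6 * k) * factor a b (6 * k + 1)).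
{ rewrite Nat.add_1_r, partial_product_S.
  destruct (Nat.eqb_spec (S (6 * k)) 3); [lia|easy]. }
rewrite <- H1.
destruct r as [|[|[|[|[|r]]]]]; try lia; rewrite ?H by lia; easy.
Qed.

Lemma partial_product_residue_5 (a b : R) (k : nat) :
  1 < b < 3 ->
  partial_product a b (6 * k + 5) = partial_product a b (6 * k) * exp (logpair a b k).
Proof.
intros Hb.
rewrite (Nat.add_succ_r (6 * k) 4), partial_product_S, <- Nat.add_succ_r.
destruct (Nat.eqb_spec (6 * k + 5) 3); [lia|].
rewrite partial_product_residue_1, factor_exp by (auto; lia).
unfold logpair, Rminus. rewrite exp_plus.
change (chi6 5) with (-1)%Z.
replace (-1 * logfactor a b (6 * k + 5)) with (- logfactor a b (6 * k + 5)) by ring.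
ring.
Qed.

Lemma partial_product_residue_0 (a b : R) (k : nat) :
  1 < b < 3 -> partial_product a b (6 * k) = exp (Rsum (logpair a b) k).
Proof.
intros Hb. induction k as [|k IH].
- simpl. rewrite exp_0. easy.
- simpl Rsum. rewrite exp_plus, <- IH, <- partial_product_residue_5 by easy.
  replace (6 * S k)%nat with (S (6 * k + 5)) by lia.
  rewrite partial_product_S. destruct (Nat.eqb_spec (S (6 * k + 5)) 3); [lia|].
  rewrite <- Nat.add_succ_r, factor_trivial by easy. ring.
Qed.

Lemma is_lim_seq_residues (d : nat) (u : nat -> R) (l : R) :
  (0 < d)%nat ->
  (forall r, (r < d)%nat -> is_lim_seq (fun k => u (d * k + r)%nat) l) ->
  is_lim_seq u l.
Proof.
intros Hd H. apply is_lim_seq_spec. intros eps.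
assert (HM : forall m, (m <= d)%nat -> exists M, forall r k, (r < m)%nat ->
  (M <= k)%nat -> Rabs (u (d * k + r)%nat - l) < eps).
{ induction m as [|m IH]; intros Hm.
  - exists O. lia.
  - destruct IH as [M1 H1]; [lia|].
    assert (H2 := H m ltac:(lia)). apply is_lim_seq_spec in H2.
    destruct (H2 eps) as [M2 H3].
    exists (M1 + M2)%nat. intros r k Hr Hk.
    destruct (Nat.eq_dec r m) as [->|Hne]; [apply H3|apply H1]; lia. }
destruct (HM d (Nat.le_refl d)) as [M HM'].
exists (d * M)%nat. intros n Hn.
rewrite (Nat.div_mod_eq n d).
apply HM'; [apply Nat.mod_upper_bound; lia|].
apply Nat.div_le_lower_bound; lia.
Qed.

Theorem proposition11 (alpha beta : R)
  (halpha : 0 < alpha)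
  (hbeta : 1 < beta < 3)
  (hrel : tanh (PI * alpha / 6) * tan (PI * beta / 6) = 1 / sqrt 3) :
  is_lim_seq (partial_product alpha beta)
    (Finite (exp (- (PI * alpha * beta / 3)))).
Proof.
assert (Hexp : forall u l, is_lim_seq u (Finite l) ->
  is_lim_seq (fun k => exp (u k)) (Finite (exp l))).
{ intros u l Hu. apply (is_lim_seq_continuous exp); [|easy].
  apply derivable_continuous_pt, derivable_pt_exp. }
assert (HS : is_lim_seq (Rsum (logpair alpha beta)) (- (PI * alpha * beta / 3))).
{ assert (H := defect_lim alpha halpha). unfold defect in H.
  rewrite <- (curve_unique alpha beta halpha hbeta hrel) in H.
  replace (- (PI * alpha * beta / 3)) with (0 - PI / 3 * (alpha * beta)) by field.
  eapply is_lim_seq_ext; [|apply (is_lim_seq_minus' _ _ _ _ H (is_lim_seq_const _))].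
  intros k. simpl. ring. }
assert (HL : is_lim_seq (fun k => logfactor alpha beta (6 * k + 1)) 0).
{ apply (is_lim_seq_subseq (logfactor alpha beta) 0 (fun k => (6 * k + 1)%nat));
    [|apply logfactor_lim].
  apply eventually_subseq. intros k. lia. }
apply (is_lim_seq_residues 6); [lia|]. intros r Hr.
assert (Hcase : r = 0%nat \/ (1 <= r <= 4)%nat \/ r = 5%nat) by lia.
destruct Hcase as [->|[H14| ->]].
- apply (is_lim_seq_ext (fun k => exp (Rsum (logpair alpha beta) k))).
  + intros k. rewrite Nat.add_0_r, partial_product_residue_0 by easy. easy.
  + apply Hexp, HS.
- apply (is_lim_seq_ext (fun k =>
    exp (Rsum (logpair alpha beta) k + logfactor alpha beta (6 * k + 1)))).
  + intros k. rewrite exp_plus, partial_product_residue_1, partial_product_residue_0 by easy. easy.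
  + apply Hexp. rewrite <- (Rplus_0_r (- _)). apply is_lim_seq_plus'; easy.
- apply (is_lim_seq_ext (fun k => exp (Rsum (logpair alpha beta) (S k)))).
  + intros k. rewrite partial_product_residue_5, partial_product_residue_0, <- exp_plus by easy. easy.
  + apply Hexp. apply (is_lim_seq_incr_1 (Rsum (logpair alpha beta))), HS.
Qed.
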